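(* Let $\mathcal{F}\leq\mathcal{G}$ be finitely generated abelian groups with $n$ generators, where the $\mathcal{G}$-grading is positive, and let $B$ be a list of $n$ integer vectors such that $Sat(L_{\mathcal{F}})=L_{\mathbb{Z}B}$. Then $$\gamma\left(\overline{\mathbb{G}(\mathcal{D}_{\mathcal{F}}^{\mathcal{G}})}\right)\leq \delta(\mathcal{D}_{\mathcal{F}}^{\mathcal{G}})_{\Omega}\leq \mathrm{ara}_{\mathbb{Z}B}(I_{L_{\mathcal{G}}})\leq \mathrm{ara}_{\mathcal{F}}(I_{L_{\mathcal{G}}}).$$
   Context: Let $K$ be a field and $S=K[x_1,\ldots,x_n]$. A finitely generated abelian group with $n$ generators, written $\mathcal{G}=\langle \mathbf{g}_1,\ldots,\mathbf{g}_n\rangle$, is an abelian group together with a distinguished ordered list of $n$ generators. Put $\deg_{\mathcal{G}}(\mathbf{u})=u_1\mathbf{g}_1+\cdots+u_n\mathbf{g}_n$ for $\mathbf{u}\in\mathbb{Z}^n$ and $L_{\mathcal{G}}=\{\mathbf{u}\in\mathbb{Z}^n: \deg_{\mathcal{G}}(\mathbf{u})=\mathbf{0}\}$. A polynomial is $\mathcal{G}$-homogeneous if all monomials $\mathbf{x}^{\mathbf{u}}$ occurring in it with nonzero coefficient have the same $\deg_{\mathcal{G}}(\mathbf{u})$; an ideal is $\mathcal{G}$-homogeneous if it is generated by $\mathcal{G}$-homogeneous polynomials. $\mathcal{F}\leq\mathcal{G}$ (''$\mathcal{F}$ is a specialization of $\mathcal{G}$'') means that every $\mathcal{G}$-homogeneous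 ideal of $S$ is $\mathcal{F}$-homogeneous. The $\mathcal{G}$-grading is positive if $L_{\mathcal{G}}\cap\mathbb{N}^n=\{\mathbf{0}\}$. For a lattice $L\subset\mathbb{Z}^n$, $I_L\subset S$ is the ideal generated by all $\mathbf{x}^{\alpha_+}-\mathbf{x}^{\alpha_-}$ with $\alpha=\alpha_+-\alpha_-\in L$ ($\alpha_\pm\in\mathbb{N}^n$ the positive and negative parts), and $Sat(L)=\{\alpha\in\mathbb{Z}^n: d\alpha\in L \text{ for some } d\in\mathbb{Z}\setminus\{0\}\}$. For a list $A=\{\mathbf{a}_1,\ldots,\mathbf{a}_n\}$ of integer vectors, $\mathbb{Z}A$ is the group spanned by $A$ with ordered generators $\mathbf{a}_1,\ldots,\mathbf{a}_n$, so $L_{\mathbb{Z}A}=\{\mathbf{u}\in\mathbb{Z}^n:\sum u_i\mathbf{a}_i=\mathbf{0}\}$. For every $\mathcal{G}$ there is such an $A$ with $Sat(L_{\mathcal{G}})=L_{\mathbb{Z}A}$; fix one and put $\sigma_{\mathcal{G}}=pos_{\mathbb{Q}}(A)=\{\sum d_i\mathbf{a}_i: d_i\in\mathbb{Q}_{\geq0}\}$. Likewise $\sigma_{\mathcal{F}}=pos_{\mathbb{Q}}(B)$, with $B=\{\mathbf{b}_1,\ldots,\mathbf{b}_n\}$ and $Sat(L_{\mathcal{F}})=L_{\mathbb{Z}B}$. If $\mathcal{F}\leq\mathcal{G}$, then $\pi:\sigma_{\mathcal{G}}\to\sigma_{\mathcal{F}}$ denotes the corresponding projection of cones, i.e. the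 restriction of a $\mathbb{Q}$-linear map with $\pi(\mathbf{a}_i)=\mathbf{b}_i$ for all $i$. Positivity of the $\mathcal{G}$-grading is equivalent to $\sigma_{\mathcal{G}}$ being strongly convex ($\{\mathbf{0}\}$ is a face). In that case $\sigma_{\mathcal{G}}=pos_{\mathbb{Q}}(\mathbf{r}_1,\ldots,\mathbf{r}_t)$, with one integer vector $\mathbf{r}_i$ for each extreme ray (one-dimensional face). For $E\subset\{1,\ldots,t\}$ put $\sigma_{\mathcal{G}}(E)=pos_{\mathbb{Q}}(\mathbf{r}_i: i\in E)$. Among the subcones $\sigma_{\mathcal{G}}(E)$ that are not faces of $\sigma_{\mathcal{G}}$, ordered by inclusion, let $\sigma_{\mathcal{G}}(\mathbb{E}_1),\ldots,\sigma_{\mathcal{G}}(\mathbb{E}_f)$ be the minimal ones. The relative interior $relint_{\mathbb{Q}}$ of a cone generated by finitely many vectors is the set of all strictly positive rational linear combinations of the generators. $\mathcal{D}_{\mathcal{F}}^{\mathcal{G}}$ is the simplicial complex with vertices $\{\mathbb{E}_1,\ldots,\mathbb{E}_f\}$ such that $T\subset\{\mathbb{E}_1,\ldots,\mathbb{E}_f\}$ belongs to it if and only if $\bigcap_{\mathbb{E}_i\in T}relint_{\mathbb{Q}}(\pi(\sigma_{\mathcal{G}}(\mathbb{E}_i)))\neq\emptyset$. For a simplicial complex $\mathcal{D}$ with $\Omega=\{0,1,\ldots,\dim\mathcal{D}\}$: an $\Omega$-matching is a set $\mathcal{M}=\{T_1,\ldots,T_s\}$ of pairwise disjoint (nonempty)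 simplices of $\mathcal{D}$; its support is $\bigcup_i T_i$ and $card(\mathcal{M})=s$. It is maximal if its support has the maximum possible cardinality among all $\Omega$-matchings. $\delta(\mathcal{D})_{\Omega}$ is the minimum of $card(\mathcal{M})$ over all maximal $\Omega$-matchings $\mathcal{M}$. $\mathbb{G}(\mathcal{D})$ is the simple graph formed by the simplices of $\mathcal{D}$ of dimension at most $1$, $\overline{\mathbb{G}(\mathcal{D})}$ is its complement graph, and $\gamma$ denotes the chromatic number. For a specialization $\mathcal{F}$ of $\mathcal{G}$ and a $\mathcal{G}$-homogeneous ideal $J$ (such as $I_{L_{\mathcal{G}}}$), $\mathrm{ara}_{\mathcal{F}}(J)$ is the smallest integer $s$ such that there are $\mathcal{F}$-homogeneous polynomials $F_1,\ldots,F_s$ with $rad(J)=rad(F_1,\ldots,F_s)$. (The group $\mathbb{Z}B$ is a specialization of $\mathcal{F}$, hence of $\mathcal{G}$.) *)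

(* Defs.v *)
(* Mathematical Components, with the classical layer of MathComp-Analysis
   (sets as predicates) and multinomials. *)
From mathcomp Require Import all_boot all_order all_algebra.
From mathcomp Require Import boolp classical_sets.
From mathcomp Require Import mpoly.

Set Implicit Arguments.
Unset Strict Implicit.
Unset Printing Implicit Defensive.

Import Order.TTheory GRing.Theory Num.Theory.
Local Open Scope ring_scope.

(* The least element of a nonempty set of naturals (and 0 for the empty set). *)
Definition minimum (P : set nat) : nat :=
  xget 0%N [set k | P k /\ forall k', P k' -> (k <= k')%N]%classic.

(** * Groups with n generators and lattices *)

(* A group with n generators is given by the list g of its generators in a
   Z-module G with [generates g]. All the notions below only depend on the list
   g, so that the group ZB spanned by a list b of integer vectors is given by
   b : 'I_n -> 'rV[int]_q itself, without forming the subgroup of Z^q. *)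
Section Groups.
Variables (n : nat) (G : zmodType) (g : 'I_n -> G).

Definition gdeg (u : 'rV[int]_n) : G := \sum_i g i *~ u 0 i.

Definition generates : Prop := forall x : G, exists u, x = gdeg u.

Definition relations : set 'rV[int]_n := [set u | gdeg u = 0]%classic.

Definition positive_grading : Prop :=
  forall u, relations u -> (forall i, 0 <= u 0 i) -> u = 0.

End Groups.

Definition Sat (n : nat) (L : set 'rV[int]_n) : set 'rV[int]_n :=
  [set u | exists2 d : int, d != 0 & L (d *: u)]%classic.

(** * Polynomials and ideals *)

Section Ideals.
Variables (K : fieldType) (n : nat).
Local Notation S := {mpoly K[n]}.

Definition exponent (m : 'X_{1..n}) : 'rV[int]_n := \row_i (m i)%:Z.

Definition homogeneous (G : zmodType) (g : 'I_n -> G) (f : S) : Prop :=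
  forall m m', m \in msupp f -> m' \in msupp f ->
    gdeg g (exponent m) = gdeg g (exponent m').

Definition ideal (P : set S) : set S :=
  [set f | exists2 s : seq (S * S), forall x, x \in s -> P x.2
                                  & f = \sum_(x <- s) x.1 * x.2]%classic.

Definition radical (J : set S) : set S := [set f | exists k, J (f ^+ k)]%classic.

Definition homogeneous_ideal (G : zmodType) (g : 'I_n -> G) (J : set S) : Prop :=
  exists2 P : set S, forall f, P f -> homogeneous g f & J = ideal P.

(* F <= G *)
Definition specialization (F G : zmodType) (f : 'I_n -> F) (g : 'I_n -> G) : Prop :=
  forall J : set S, homogeneous_ideal g J -> homogeneous_ideal f J.

Definition pos_part (u : 'rV[int]_n) : 'X_{1..n} :=
  [multinom absz (Num.max (u 0 i) 0)%R | i < n].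
Definition neg_part (u : 'rV[int]_n) : 'X_{1..n} := pos_part (- u).

Definition lattice_ideal (L : set 'rV[int]_n) : set S :=
  ideal [set f | exists2 u, L u & f = 'X_[pos_part u] - 'X_[neg_part u]]%classic.

Definition ara (G : zmodType) (g : 'I_n -> G) (J : set S) : nat :=
  minimum [set s | exists2 f : 'I_s -> S, forall i, homogeneous g (f i)
                     & radical J = radical (ideal (range f))]%classic.

End Ideals.

Arguments lattice_ideal K {n} L.

(** * Rational cones *)

Section Cones.
Variable p : nat.
Local Notation V := 'rV[rat]_p.

Definition ratv (u : 'rV[int]_p) : V := map_mx intr u.

(* pos_Q (v_i : i in E) *)
Definition pos (I : finType) (v : I -> V) (E : {set I}) : set V :=
  [set x | exists2 d : I -> rat, forall i, i \in E -> 0 <= d i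
                               & x = \sum_(i in E) d i *: v i]%classic.

(* The relative interior of pos v E. *)
Definition relint (I : finType) (v : I -> V) (E : {set I}) : set V :=
  [set x | exists2 d : I -> rat, forall i, i \in E -> 0 < d i
                               & x = \sum_(i in E) d i *: v i]%classic.

Definition is_face (sigma F : set V) : Prop :=
  exists2 c : 'cV[rat]_p, forall x, sigma x -> 0 <= (x *m c) 0 0
                        & F = [set x | sigma x /\ (x *m c) 0 0 = 0]%classic.

Definition has_dim (C : set V) (d : nat) : Prop :=
  exists U : {vspace V},
    [/\ forall x, C x -> x \in U,
        forall W : {vspace V}, (forall x, C x -> x \in W) -> (U <= W)%VS
      & \dim U = d].

Definition extreme_ray (sigma F : set V) : Prop :=
  is_face sigma F /\ has_dim F 1.

(* r consists of one integer vector for each extreme ray of sigma. *)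
Definition extreme_vectors (sigma : set V) (t : nat) (r : 'I_t -> 'rV[int]_p) :=
  let ray i := pos (ratv \o r) [set i] in
  [/\ forall i, extreme_ray sigma (ray i),
      injective ray
    & forall F, extreme_ray sigma F -> exists i, F = ray i].

Definition minimal_nonface (sigma : set V) (t : nat) (r : 'I_t -> V)
    (E : {set 'I_t}) : Prop :=
  ~ is_face sigma (pos r E) /\
  forall E', ~ is_face sigma (pos r E') -> (pos r E' `<=` pos r E)%classic ->
    pos r E' = pos r E.

End Cones.

Arguments ratv {p} u.

(* The image of a cone is the cone generated by the images of the generators;
   its relative interior is relint (pi \o v) E. *)
Lemma image_pos (p q : nat) (pi : {linear 'rV[rat]_p -> 'rV[rat]_q})
    (I : finType) (v : I -> 'rV[rat]_p) (E : {set I}) :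
  (pi @` pos v E)%classic = pos (pi \o v) E.
Proof.
apply/seteqP; split=> [_ [_ [d d0 ->] <-]|_ [d d0 ->]].
  by exists d => //; rewrite linear_sum; apply: eq_bigr => i _; rewrite linearZ.
exists (\sum_(i in E) d i *: v i); first by exists d.
by rewrite linear_sum; apply: eq_bigr => i _; rewrite linearZ.
Qed.

(** * Finite simplicial complexes *)

(* A simplicial complex whose set of vertices is the whole of V. *)
Record complex (V : finType) := Complex {
  simplices :> {set {set V}};
  complex_vertex : forall x, [set x] \in simplices;
  complex_sub : forall T T' : {set V},
    T \in simplices -> T' \subset T -> T' \in simplices }.

Section Complex.
Variables (V : finType) (D : complex V).

(* An Omega-matching, for Omega = {0, ..., dim D}: all the dimensions of
   nonempty simplices are allowed. *)
Definition matching (M : {set {set V}}) : bool :=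
  [&& M \subset simplices D, finset.set0 \notin M & finset.trivIset M].

Definition maximal_matching (M : {set {set V}}) : bool :=
  matching M && [forall M', matching M' ==> (#|finset.cover M'| <= #|finset.cover M|)%N].

Definition delta : nat :=
  minimum [set k | exists2 M, maximal_matching M & k = #|M|]%classic.

(* The graph of the simplices of dimension at most 1, by its edge relation. *)
Definition skeleton_graph : rel V :=
  fun x y => (x != y) && ([set x; y]%SET \in simplices D).

End Complex.

(** * Simple graphs, as irreflexive symmetric edge relations *)

Definition complement_graph (V : finType) (e : rel V) : rel V :=
  fun x y => (x != y) && ~~ e x y.

Definition chromatic_number (V : finType) (e : rel V) : nat :=
  minimum [set k | exists c : V -> 'I_k, forall x y, e x y -> c x != c y]%classic.

(** * The complex D_F^G *)

Section MainComplex.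
Variables (p q t : nat) (sigma : set 'rV[rat]_p) (r : 'I_t -> 'rV[rat]_p).
Variable pi : {linear 'rV[rat]_p -> 'rV[rat]_q}.

(* A subcone pos r E is represented by E: when the r i generate the distinct
   extreme rays of a strongly convex cone, pos r E determines E. *)
Definition nonface_type : finType :=
  {E : {set 'I_t} | `[< minimal_nonface sigma r E >]}.

Definition D_simplices : {set {set nonface_type}} :=
  [set T : {set nonface_type} |
    `[< exists x, forall E, E \in T -> relint (pi \o r) (val E) x >]].

Lemma D_vertex x : [set x] \in D_simplices.
Proof.
rewrite inE; apply/asboolP; exists (\sum_(i in val x) (pi \o r) i) => E /set1P ->.
by exists (fun=> 1) => // ; apply: eq_bigr => i _; rewrite scale1r.
Qed.

Lemma D_sub (T T' : {set nonface_type}) :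
  T \in D_simplices -> T' \subset T -> T' \in D_simplices.
Proof.
move=> DT /fintype.subsetP sT; move: DT; rewrite !inE => -[x xT].
by exists x => E /sT; apply: xT.
Qed.

Definition D_complex : complex nonface_type := Complex D_vertex D_sub.

End MainComplex.

(* Main.v *)
Require Import Defs.
From mathcomp Require Import all_boot all_order all_algebra.
From mathcomp Require Import boolp classical_sets.
From mathcomp Require Import zify.
From mathcomp Require Import mpoly.

Set Implicit Arguments.
Unset Strict Implicit.
Unset Printing Implicit Defensive.

Import Order.TTheory GRing.Theory Num.Theory.
Local Open Scope ring_scope.

(** The first inequality is a coloring argument. Every vertex of a complex is a
    simplex, so the singletons form a matching that covers all the vertices, and
    a maximal matching therefore partitions the vertices into simplices. Two
    vertices of one simplex are adjacent in the graph of the complex, hence not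
    in its complement, and coloring each vertex by its block is proper
    ([chromatic_number_le_delta]).

    For the last inequality, the relations of F lie in their saturation, which
    is the lattice of relations of B, so that F-homogeneous polynomials are
    ZB-homogeneous and a family realizing ara_F is also a candidate for ara_ZB.
    Because the minimum of an empty set of naturals is 0 here, a finite
    candidate has to exist: J is F-homogeneous because F specializes G, and
    finitely many of its F-homogeneous generators suffice by Hilbert's basis
    theorem ([hilbert_basis], from Dickson's lemma).

    The middle inequality carries the theorem. Let P_1, ..., P_s be
    ZB-homogeneous with the same radical as J, and write sigma(E) for the
    subcone spanned by the rays in E. The key is that for every minimal nonface
    E, some P_i has a monomial whose A-degree is in the relative interior of
    sigma(E) ([nonface_monomial]). Once this is known, pi maps the A-degree of a
    monomial to its B-degree, which is the same vector for all the monomials of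
    P_i; so this vector is common to the relative interiors of the pi(sigma(E)),
    for all the E that are assigned to the index i. These E form a simplex, and
    the vertices are covered by at most s disjoint simplices.

    To find the monomial, for W contained in E let x_W be the point of K^n with
    coordinate 1 at the k such that a_k is in sigma(W), and 0 elsewhere. If W is
    a proper subset of E then sigma(W) is a face, by minimality of E. A sum of
    vectors of the cone is in a face only if its terms are, hence each binomial
    generating J has either both or none of its monomials supported on the
    coordinates of that face, and all the P_i vanish at x_W ([face_point]).
    On the other hand sigma(E) is not a face, and by Farkas' lemma there is a
    relation that expresses an element of sigma(E) as a nonnegative combination
    of the a_k in which some a_k outside sigma(E) occurs. This gives a binomial
    of J with value 1 at x_E ([nonface_point]), so P_i(x_E) is nonzero for some
    i. The value of P_i at x_W is the sum of its coefficients over the monomials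
    supported on x_W. By inclusion-exclusion over the sets E \ j, and since the
    values at proper subsets vanish, P_i(x_E) is also the sum over the monomials
    whose degree is in sigma(E) but in none of the sigma(E \ j)
    ([sum_sieve]). Such degrees are in the relative interior of sigma(E), and
    there must be one because the sum is nonzero. *)

(** * Minima, matchings and colorings of complexes *)

Lemma minimumP (P : set nat) : (exists k, P k) ->
  P (minimum P) /\ forall k, P k -> (minimum P <= k)%N.
Proof.
move=> exP; rewrite /minimum.
apply: (xgetPex 0%N (P := [set k | P k /\ forall k', P k' -> (k <= k')%N]%classic)).
have [k Pk]: exists k, `[< P k >] by case: exP => k Pk; exists k; apply/asboolP.
case: (ex_minnP (ex_intro (fun k => `[< P k >]) k Pk)) => m /asboolP Pm mP.
by exists m; split=> // k' Pk'; apply/mP/asboolP.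
Qed.

Lemma minimum_le (P : set nat) k : P k -> (minimum P <= k)%N.
Proof. by move=> Pk; apply: (minimumP _).2 => //; exists k. Qed.

Section Matchings.
Variables (V : finType) (D : complex V).

Lemma fiber_matching s (c : V -> 'I_s) :
    (forall i, [set x | c x == i] \in simplices D) ->
  exists2 M, matching D M & finset.cover M = [set: V]%SET /\ (#|M| <= s)%N.
Proof.
move=> cD; pose fiber i := [set x | c x == i].
exists (fiber @: (c @: V)); last split.
- apply/and3P; split.
  + by apply/fintype.subsetP => _ /imsetP [i _ ->]; exact: cD.
  + apply/imsetP => -[_ /imsetP [x _ ->]] /setP /(_ x).
    by rewrite !inE eqxx.
  + apply/finset.trivIsetP => _ _ /imsetP [i _ ->] /imsetP [j _ ->] neq.
    rewrite -setI_eq0; apply/set0Pn => -[x]; rewrite !inE => /andP[/eqP ci /eqP cj].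
    by move/eqP: neq; apply; rewrite -ci -cj.
- apply/setP=> x; rewrite inE; apply/bigcupP.
  exists (fiber (c x)); last by rewrite inE.
  by apply: imset_f; apply: imset_f.
- rewrite (leq_trans (leq_imset_card _ _)) //.
  by rewrite (leq_trans (max_card _)) // card_ord.
Qed.

(** Once one matching covers all the vertices, the maximal ones are those that
    cover all the vertices. *)
Lemma cover_maximal M0 M : matching D M0 -> finset.cover M0 = [set: V]%SET ->
  maximal_matching D M = matching D M && (finset.cover M == [set: V]%SET).
Proof.
move=> M0m M0c; rewrite /maximal_matching; case: (matching D M) => //=.
apply/forallP/eqP => [/(_ M0)|-> M'].
  rewrite M0m M0c /= => le; apply/eqP; rewrite eqEcard finset.subsetT /=; exact: le.
by apply/implyP=> _; apply: subset_leq_card; apply: finset.subsetT.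
Qed.

(** The nonempty fibers of [c] form a matching that covers all the vertices. *)
Lemma delta_le_fibers s (c : V -> 'I_s) :
  (forall i, [set x | c x == i] \in simplices D) -> (delta D <= s)%N.
Proof.
move=> /fiber_matching [M Mm [Mc Ms]]; apply: leq_trans Ms.
by apply: minimum_le; exists M => //; rewrite (cover_maximal _ Mm Mc) Mm Mc eqxx.
Qed.

Lemma singletons_matching : exists2 M, matching D M & finset.cover M = [set: V]%SET.
Proof.
have [i|M Mm [Mc _]] := @fiber_matching _ (@enum_rank V); last by exists M.
rewrite (_ : [set _ | _] = [set enum_val i]); first exact: complex_vertex.
by apply/setP=> x; rewrite !inE -(inj_eq enum_val_inj) enum_rankK.
Qed.

(** The blocks of a maximal matching are cliques of the graph, hence independent
    sets of its complement: they serve as color classes. *)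
Lemma chromatic_number_le_delta :
  (chromatic_number (complement_graph (skeleton_graph D)) <= delta D)%N.
Proof.
have [M0 M0m M0c] := singletons_matching.
have [|] := @minimumP [set k | exists2 M, maximal_matching D M & k = #|M|]%classic.
  by exists #|M0|, M0 => //; rewrite (cover_maximal _ M0m M0c) M0m M0c eqxx.
rewrite -/(delta D) => -[M]; rewrite (cover_maximal _ M0m M0c).
move=> /andP[/and3P[/fintype.subsetP MD M0' Mt] /eqP Mc] -> _.
apply: minimum_le.
have blockP x : finset.pblock M x \in M by rewrite pblock_mem // Mc inE.
exists (fun x => enum_rank_in (blockP x) (finset.pblock M x)) => x y.
move=> /andP[xy]; apply: contra => /eqP eq_c.
have eq_b : finset.pblock M x = finset.pblock M y.
  have := congr1 (@enum_val _ _) eq_c.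
  by rewrite !enum_rankK_in.
rewrite /skeleton_graph xy; apply: (complex_sub (MD _ (blockP x))).
apply/fintype.subsetP => z /set2P[]->; last rewrite eq_b; by rewrite mem_pblock Mc inE.
Qed.

End Matchings.

(** * Ideals and Hilbert's basis theorem *)

(** If x satisfies P, then an m satisfying P is above x unless m i < x i for
    some i. In the latter case it lies in one of the finitely many slices
    m i = v with v < x i, where one more coordinate is fixed. The induction is on
    the number of free coordinates, those outside [Z], on which the elements of
    P may differ. *)
Lemma dickson (n : nat) (P : 'X_{1..n} -> Prop) :
  exists2 l : seq 'X_{1..n}, forall x, x \in l -> P x
    & forall m, P m -> exists2 x, x \in l & (x <= m)%MM.
Proof.
have: forall m m' : 'X_{1..n}, P m -> P m' ->
    forall i, i \in (finset.set0 : {set 'I_n}) -> m i = m' i.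
  by move=> m m' _ _ i; rewrite inE.
move: {2}#|_| (leqnn #|~: (finset.set0 : {set 'I_n})|) => k.
elim: k (finset.set0 : {set 'I_n}) P => [|k IH] Z P Zk PZ.
all: have [[x Px]|P0] := pselect (exists x, P x); last first.
all: try by exists [::] => // m Pm; case: P0; exists m.
  exists [:: x] => [y|m Pm]; first by rewrite inE => /eqP->.
  exists x; rewrite ?inE //; apply/mnm_lepP => i; rewrite (PZ x m) //.
  by move: Zk; rewrite leqn0 cards_eq0 => /eqP /setP /(_ i); rewrite !inE => /negbFE.
(* The sum of the x i serves as a common bound for the values v < x i. *)
have slice (iv : 'I_n * 'I_(\sum_i x i).+1) : exists l : seq 'X_{1..n},
    (forall y, y \in l -> P y) /\
    forall m, P m -> iv.1 \notin Z -> m iv.1 = iv.2 -> exists2 y, y \in l & (y <= m)%MM.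
  case: iv => i v /=; have [iZ|iZ] := boolP (i \in Z); first by exists [::].
  have [||l lP ll] := IH (i |: Z) (fun m => P m /\ m i = v).
  - rewrite -ltnS; apply: leq_trans Zk; apply: proper_card.
    by rewrite finset.setCU finset.setIC -finset.setDE properD1 // inE.
  - by move=> m m' [Pm mi] [Pm' m'i] j /setU1P [->|/PZ]; [rewrite mi m'i | apply].
  - by exists l; split=> [y /lP[] //|m Pm _ mi]; apply: ll.
have {slice} [l lP] := choice slice.
exists (x :: flatten [seq l iv | iv <- enum {: 'I_n * 'I_(\sum_i x i).+1}]).
  by move=> y /predU1P[->//|/flattenP[_ /mapP[iv _ ->]]]; apply: (lP iv).1.
move=> m Pm; have [xm|xm] := boolP (x <= m)%MM; first by exists x; rewrite ?mem_head.
have [i mx] : exists i, (m i < x i)%N.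
  apply/existsP; apply: contraR xm; rewrite negb_exists => /forallP xm.
  by apply/mnm_lepP => i; rewrite leqNgt.
have iZ : i \notin Z by apply: contraTN mx => iZ; rewrite (PZ x m) // ltnn.
have mi : (m i < (\sum_i x i).+1)%N.
  by rewrite ltnS (leq_trans (ltnW mx)) // (bigD1 i) //= leq_addr.
have [y yl ym] := (lP (i, Ordinal mi)).2 m Pm iZ erefl.
exists y => //; rewrite inE; apply/orP; right; apply/flattenP.
by exists (l (i, Ordinal mi)) => //; apply: map_f; rewrite mem_enum.
Qed.

Section IdealTheory.
Variables (K : fieldType) (n : nat).
Local Notation S := {mpoly K[n]}.
Implicit Types (P Q : set S).

Lemma ideal_gen P f : P f -> ideal P f.
Proof.
by move=> Pf; exists [:: (1, f)] => [x|]; rewrite ?big_seq1 ?mul1r // inE => /eqP->.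
Qed.

Lemma ideal0 P : ideal P 0.
Proof. by exists [::] => //; rewrite big_nil. Qed.

Lemma idealD P f h : ideal P f -> ideal P h -> ideal P (f + h).
Proof.
move=> [s sP ->] [s' s'P ->]; exists (s ++ s'); last by rewrite big_cat.
by move=> x; rewrite mem_cat => /orP[/sP|/s'P].
Qed.

Lemma idealMl P f h : ideal P h -> ideal P (f * h).
Proof.
move=> [s sP ->]; exists [seq (f * x.1, x.2) | x <- s].
  by move=> _ /mapP[x xs ->] /=; apply: sP.
by rewrite big_map mulr_sumr; apply: eq_bigr => x _; rewrite mulrA.
Qed.

Lemma ideal_sub P Q : (forall f, P f -> ideal Q f) -> forall f, ideal P f -> ideal Q f.
Proof.
move=> PQ _ [s sP ->]; elim: s sP => [|x s IH] sP; first by rewrite big_nil; apply: ideal0.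
rewrite big_cons; apply: idealD.
  by apply: idealMl; apply: PQ; apply: sP; rewrite mem_head.
by apply: IH => y ys; apply: sP; rewrite inE ys orbT.
Qed.

Lemma meval_ideal P v : (forall f, P f -> f.@[v] = 0) -> forall f, ideal P f -> f.@[v] = 0.
Proof.
move=> P0 _ [s sP ->]; rewrite raddf_sum big_seq big1 // => x /sP /P0.
by rewrite /= mevalM => ->; rewrite mulr0.
Qed.

(** Vanishing at a point passes to the radical because K is reduced. *)
Lemma meval_radical P v : (forall f, P f -> f.@[v] = 0) ->
  forall f, radical (ideal P) f -> f.@[v] = 0.
Proof.
move=> P0 f [k /(meval_ideal P0)]; rewrite rmorphXn => /eqP.
by rewrite expf_eq0 => /andP[_ /eqP].
Qed.

(** Division by the elements of l: subtracting from f the multiple of h with the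
    same leading term lowers the leading monomial. *)
Lemma leading_basis P (l : seq S) :
    (forall h, h \in l -> ideal P h) ->
    (forall f, ideal P f -> f != 0 ->
       exists2 h, h \in l & h != 0 /\ (mlead h <= mlead f)%MM) ->
  forall f, ideal P f -> ideal [set h | h \in l]%classic f.
Proof.
move=> lP lead; elim/mleadrect => f IH Pf.
have [->|f0] := eqVneq f 0; first exact: ideal0.
have [h hl [h0 hf]] := lead f Pf f0.
pose c := mleadc f / mleadc h; pose m := (mlead f - mlead h)%MM.
have c0 : c != 0 by rewrite mulf_neq0 ?invr_eq0 ?mleadc_eq0.
have X0 : 'X_[m] != 0 :> S.
  by rewrite -mleadc_eq0 mleadXm mcoeffX eqxx oner_eq0.
have mh : mlead (c *: ('X_[m] * h)) = mlead f.
  by rewrite mleadZ // mleadM // mleadXm submK.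
rewrite -[f](subrK (c *: ('X_[m] * h))).
have lh : ideal [set h | h \in l]%classic (c *: ('X_[m] * h)).
  by rewrite scalerAl; apply: idealMl; apply: ideal_gen.
have [d0|d0] := eqVneq (f - c *: ('X_[m] * h)) 0; first by rewrite d0 add0r.
apply: idealD => //; apply: IH; last first.
  by rewrite -scaleNr scalerAl; apply: idealD => //; apply: idealMl; apply: lP.
rewrite lt_neqAle; apply/andP; split; last first.
  by apply: le_trans (mleadB_le _ _) _; rewrite mh leUx lexx.
apply: contraNneq d0 => eq_lead; rewrite -mleadc_eq0 eq_lead mcoeffB mcoeffZ.
have -> : ('X_[m] * h)@_(mlead f) = mleadc h.
  by rewrite -mh mleadZ // mleadM // mleadcM mleadXm mcoeffX eqxx mul1r.
by rewrite divfK ?subrr // mleadc_eq0.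
Qed.

(** Dickson's lemma applied to the leading monomials of the ideal. The generators
    are taken in P itself, which is what keeps them homogeneous when P is made of
    homogeneous polynomials: the elements with minimal leading monomials involve
    finitely many elements of P. *)
Lemma hilbert_basis P : exists2 l : seq S, forall h, h \in l -> P h
  & ideal P = ideal [set h | h \in l]%classic.
Proof.
pose lead m := exists h, [/\ ideal P h, h != 0 & mlead h = m].
have [ms msP ms_min] := dickson lead.
have [h hP] : exists h : 'X_{1..n} -> S, forall m, m \in ms ->
    [/\ ideal P (h m), h m != 0 & mlead (h m) = m].
  have /choice [h hP] : forall m, exists h, m \in ms ->
      [/\ ideal P h, h != 0 & mlead h = m].
    by move=> m; have [/msP[h ?]|_] := boolP (m \in ms); [exists h | exists 0].
  by exists h.
have gen_h f : ideal P f -> ideal [set f | f \in map h ms]%classic f.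
  apply: leading_basis => [_ /mapP[m /hP[]] // ? _ _ ->//|{}f Pf f0].
  have [|m mms mf] := ms_min (mlead f); first by exists f.
  by exists (h m); rewrite ?map_f //; have [_ h0 ->] := hP m mms.
have [c cP] : exists c : 'X_{1..n} -> seq (S * S), forall m, m \in ms ->
    (forall x, x \in c m -> P x.2) /\ h m = \sum_(x <- c m) x.1 * x.2.
  have /choice [c cP] : forall m, exists c : seq (S * S), m \in ms ->
      (forall x, x \in c -> P x.2) /\ h m = \sum_(x <- c) x.1 * x.2.
    move=> m; have [/hP[[c cP hE] _ _]|_] := boolP (m \in ms); last by exists [::].
    by exists c.
  by exists c.
pose l := [seq x.2 | x <- flatten (map c ms)].
have lP f : f \in l -> P f.
  by move=> /mapP[x /flattenP[_ /mapP[m /cP[cmP _] ->] /cmP] Px ->].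
exists l => //; apply/seteqP; split=> f.
  move/gen_h; apply: ideal_sub => _ /mapP[m mms ->].
  exists (c m) => [x xc|]; last exact: (cP m mms).2.
  by apply: map_f; apply/flattenP; exists (c m) => //; apply: map_f.
by apply: ideal_sub => h' /lP; apply: ideal_gen.
Qed.

Lemma hilbert_basis_fun P : exists s, exists2 h : 'I_s -> S, forall i, P (h i)
  & ideal P = ideal (range h).
Proof.
have [l lP ->] := hilbert_basis P.
exists (size l), (fun i => l`_i) => [i|]; first by apply/lP/mem_nth.
congr ideal; apply/seteqP; split=> [h|_ [i _ <-]]; last exact: mem_nth.
by move=> /(nthP 0)[i il <-]; exists (Ordinal il).
Qed.

End IdealTheory.

(** * Farkas' lemma *)

(** Bartl's induction on the number of vectors. If x separates w from the tail of
    v but is negative on the first vector v0, it is scaled to a vector e with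
    value -1 on v0. Adding to w and to each vector of the tail the multiple of v0
    that makes it vanish on e reduces the claim to the tail: a functional c that
    separates the new vectors is corrected by a multiple of e into one that
    vanishes on v0, and if the new w is a nonnegative combination of the new
    vectors, then the coefficient of v0 in w is nonnegative because e is
    nonnegative on the tail and negative on w. *)
Lemma farkas_ord (R : realFieldType) (p m : nat) (v : 'I_m -> 'rV[R]_p) (w : 'rV[R]_p) :
  (exists2 c : 'cV[R]_p, forall i, 0 <= (v i *m c) 0 0 & (w *m c) 0 0 < 0) \/
  (exists2 d : 'I_m -> R, forall i, 0 <= d i & w = \sum_i d i *: v i).
Proof.
elim: m v w => [|m IH] v w.
  have [->|w0] := eqVneq w 0.
    by right; exists (fun=> 0) => //; rewrite big_ord0.
  left; exists (- w^T) => [[]//|]; rewrite mulmxN !mxE oppr_lt0.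
  have [j wj] : exists j, w 0 j != 0.
    apply/existsP; apply: contraR w0; rewrite negb_exists => /forallP w0.
    by apply/eqP/rowP => j; rewrite !mxE; apply/eqP; rewrite -[_ == _]negbK w0.
  rewrite (bigD1 j) //= mxE ltr_wpDr //.
    by apply: sumr_ge0 => i _; rewrite mxE -expr2 sqr_ge0.
  by rewrite -expr2 lt_def sqrf_eq0 wj sqr_ge0.
pose v1 i := v (lift ord0 i); pose v0 := v ord0.
have [[x xv xw]|[d d0 ->]] := IH v1 w; last first.
  right; exists (fun i => oapp d 0 (unlift ord0 i)) => [i|].
    by case: unliftP => [j|] _ /=; [apply: d0|].
  rewrite big_ord_recl unlift_none scale0r add0r.
  by apply: eq_bigr => i _; rewrite liftK.
have [x0|x0] := leP 0 ((v0 *m x) 0 0).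
  by left; exists x => // i; case: (unliftP ord0 i) => [j|] ->; [exact: xv|exact: x0].
pose e := (- (v0 *m x) 0 0)^-1 *: x.
have ev u : (u *m e) 0 0 = (- (v0 *m x) 0 0)^-1 * (u *m x) 0 0.
  by rewrite -scalemxAr mxE.
have ei0 : 0 < (- (v0 *m x) 0 0)^-1 by rewrite invr_gt0 oppr_gt0.
have ev0 : (v0 *m e) 0 0 = -1.
  by rewrite ev invrN mulNr mulVf // lt_eqF.
have ev1 i : 0 <= (v1 i *m e) 0 0 by rewrite ev mulr_ge0 // ltW.
have ew : (w *m e) 0 0 < 0 by rewrite ev nmulr_llt0.
have [[c cv cw]|[d d0 wE]] :=
    IH (fun i => v1 i + (v1 i *m e) 0 0 *: v0) (w + (w *m e) 0 0 *: v0).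
  have shift u : (u *m (c + (v0 *m c) 0 0 *: e)) 0 0 = ((u + (u *m e) 0 0 *: v0) *m c) 0 0.
    by rewrite mulmxDr mulmxDl -scalemxAr -scalemxAl !mxE mulrC.
  left; exists (c + (v0 *m c) 0 0 *: e) => [i|]; last by rewrite shift.
  case: (unliftP ord0 i) => [j|] ->; rewrite -?/(v1 j) -?/v0 shift //.
  by rewrite ev0 scaleN1r subrr mul0mx mxE.
right; exists (fun i => oapp d (\sum_j d j * (v1 j *m e) 0 0 - (w *m e) 0 0) (unlift ord0 i)).
  move=> i; case: unliftP => [j|] _ //=.
  rewrite subr_ge0 (le_trans (ltW ew)) //.
  by apply: sumr_ge0 => j _; rewrite mulr_ge0.
rewrite big_ord_recl unlift_none /= -/v0.
under [X in _ + X]eq_bigr => i do rewrite liftK /= -/(v1 i).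
rewrite -[LHS](addrK ((w *m e) 0 0 *: v0)) wE scalerBl addrAC; congr (_ - _).
rewrite scaler_suml -big_split /=; apply: eq_bigr => i _.
by rewrite scalerDr scalerA addrC.
Qed.

Lemma farkas (R : realFieldType) (p : nat) (I : finType) (v : I -> 'rV[R]_p) (w : 'rV[R]_p) :
  (exists2 c : 'cV[R]_p, forall i, 0 <= (v i *m c) 0 0 & (w *m c) 0 0 < 0) \/
  (exists2 d : I -> R, forall i, 0 <= d i & w = \sum_i d i *: v i).
Proof.
have [[c cv cw]|[d d0 ->]] := farkas_ord (v \o @enum_val I predT) w.
  by left; exists c => // i; have := cv (enum_rank i); rewrite /= enum_rankK.
right; exists (d \o enum_rank) => [i|]; first exact: d0.
rewrite (reindex (@enum_rank I)) /=; last exact/onW_bij/enum_rank_bij.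
by apply: eq_bigr => i _; rewrite enum_rankK.
Qed.

(** Faces are exposed: a set T of generators admits a supporting functional
    vanishing exactly on T as soon as no linear relation has its positive
    coefficients all in T and some negative one outside T. Farkas' lemma provides, for
    each l outside T, a functional that is positive on v l, and these are summed
    up; its alternative writes - v l with nonnegative coefficients on the v k and
    on the - v k for k in T, which is a forbidden relation. *)
Lemma exposing_functional (p : nat) (I : finType) (v : I -> 'rV[rat]_p) (T : {set I}) :
    (forall w : I -> rat, \sum_k w k *: v k = 0 -> (forall k, k \notin T -> w k <= 0) ->
       forall k, k \notin T -> w k = 0) ->
  exists2 c : 'cV[rat]_p, forall k, 0 <= (v k *m c) 0 0
                        & forall k, ((v k *m c) 0 0 == 0) = (k \in T).
Proof.
move=> noT.
have /choice [c cP] : forall l, exists c : 'cV[rat]_p,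
    [/\ forall k, 0 <= (v k *m c) 0 0, forall k, k \in T -> (v k *m c) 0 0 = 0
      & l \notin T -> 0 < (v l *m c) 0 0].
  move=> l; have [lT|lT] := boolP (l \in T).
    by exists 0; split=> // k; rewrite mulmx0 mxE.
  pose u (x : I + I) := match x with inl k => v k | inr k => (k \in T)%:R *: - v k end.
  have [[c cu cl]|[d d0 lE]] := farkas u (- v l).
    exists c; split=> [k|k kT|_]; first exact: (cu (inl k)).
      apply/eqP; rewrite eq_le (cu (inl k)) andbT.
      by have := cu (inr k); rewrite /= kT scale1r mulNmx mxE oppr_ge0.
    by move: cl; rewrite mulNmx mxE oppr_lt0.
  pose w k := (k \in T)%:R * d (inr k) - d (inl k) - (k == l)%:R.
  suff: w l = 0.
    move/eqP; rewrite /w (negbTE lT) eqxx mul0r add0r -opprD oppr_eq0 paddr_eq0 //.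
    by rewrite oner_eq0 andbF.
  apply: noT => // [|k kT].
    rewrite (eq_bigr (fun k => - (d (inr k) *: u (inr k)) - d (inl k) *: u (inl k)
                               - (k == l)%:R *: v k)).
      have lE' : - v l = \sum_k d (inr k) *: u (inr k) + \sum_k d (inl k) *: u (inl k).
        by rewrite lE big_sumType addrC.
      rewrite !sumrB sumrN -opprD -lE' opprK (bigD1 l) //= eqxx scale1r big1.
        by rewrite addr0 subrr.
      by move=> k /negbTE->; rewrite scale0r.
    move=> k _; rewrite /w !scalerBl; congr (_ - _ - _).
    by rewrite /= scalerN !scalerN opprK scalerA mulrC.
  by rewrite /w (negbTE kT) mul0r add0r -opprD oppr_le0 addr_ge0.
exists (\sum_l c l) => k; rewrite mulmx_sumr summxE.
  by apply: sumr_ge0 => l _; case: (cP l).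
rewrite psumr_eq0 => [|l _]; last by case: (cP l).
apply/allP/idP => [/(_ k (mem_index_enum k))|kT l _].
  by apply: contraLR => kT; have [_ _ /(_ kT)] := cP k; rewrite implyTb lt0r => /andP[].
by rewrite implyTb; have [_ /(_ k kT) ->] := cP l.
Qed.

(** * Rays and faces of cones *)

Section ConeTheory.
Variables (p : nat) (I : finType) (v : I -> 'rV[rat]_p).
Implicit Types (E : {set I}) (x : 'rV[rat]_p).

Lemma pos0 E : pos v E 0.
Proof. by exists (fun=> 0) => //; rewrite big1 // => i _; rewrite scale0r. Qed.

Lemma posD E x y : pos v E x -> pos v E y -> pos v E (x + y).
Proof.
move=> [d d0 ->] [e e0 ->]; exists (fun i => d i + e i) => [i iE|].
  by rewrite addr_ge0 ?d0 ?e0.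
by rewrite -big_split /=; apply: eq_bigr => i _; rewrite scalerDl.
Qed.

Lemma posZ E c x : 0 <= c -> pos v E x -> pos v E (c *: x).
Proof.
move=> c0 [d d0 ->]; exists (fun i => c * d i) => [i iE|].
  by rewrite mulr_ge0 ?d0.
by rewrite scaler_sumr; apply: eq_bigr => i _; rewrite scalerA.
Qed.

Lemma pos_gen E i : i \in E -> pos v E (v i).
Proof.
move=> iE; exists (fun j => (j == i)%:R) => [j _|]; first by rewrite ler0n.
rewrite (bigD1 i) //= eqxx scale1r big1 ?addr0 // => j /andP[_ /negbTE->].
by rewrite scale0r.
Qed.

Lemma pos_sum (J : finType) (A : {pred J}) (d : J -> rat) (u : J -> 'rV[rat]_p) E :
    (forall j, j \in A -> 0 <= d j) -> (forall j, j \in A -> d j != 0 -> pos v E (u j)) ->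
  pos v E (\sum_(j in A) d j *: u j).
Proof.
move=> d0 uE; elim/big_ind: _ => [|x y|j jA]; [exact: pos0|exact: posD|].
have [->|dj] := eqVneq (d j) 0; first by rewrite scale0r; apply: pos0.
by apply: posZ; [exact: d0|exact: uE].
Qed.

Lemma posS E E' x : E \subset E' -> pos v E x -> pos v E' x.
Proof.
by move=> /fintype.subsetP sE [d d0 ->]; apply: pos_sum => // i /sE iE' _; apply: pos_gen.
Qed.

(** A coefficient that vanishes would put x in the cone of E minus one element. *)
Lemma pos_relint E x : pos v E x -> (forall i, i \in E -> ~ pos v (E :\ i) x) -> relint v E x.
Proof.
move=> [d d0 xE] xN; exists d => // i iE; rewrite lt0r d0 // andbT.
apply/eqP => di; apply: (xN i iE); exists d => [j /setD1P[_ /d0]//|].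
rewrite xE (bigD1 i) //= di scale0r add0r.
by apply: eq_bigl => j; rewrite !inE andbC.
Qed.

Lemma relint_image (q : nat) (pi : {linear 'rV[rat]_p -> 'rV[rat]_q}) E x :
  relint v E x -> relint (pi \o v) E (pi x).
Proof.
move=> [d d0 ->]; exists d => //; rewrite linear_sum; apply: eq_bigr => i _; exact: linearZ.
Qed.

End ConeTheory.

(** The functional exposing the face is nonnegative on each term and vanishes on
    the sum. *)
Lemma face_sum (p : nat) (sigma F : set 'rV[rat]_p) (J : finType) (A : {pred J})
    (d : J -> rat) (u : J -> 'rV[rat]_p) :
    is_face sigma F -> (forall j, j \in A -> sigma (u j)) -> (forall j, j \in A -> 0 <= d j) ->
    F (\sum_(j in A) d j *: u j) ->
  forall j, j \in A -> d j != 0 -> F (u j).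
Proof.
move=> [c c0 ->] us d0 [_]; rewrite mulmx_suml summxE => /eqP.
rewrite psumr_eq0 => [/allP u0 j jA dj|j jA]; last first.
  by rewrite -scalemxAl mxE mulr_ge0 ?d0 //; apply: c0; apply: us.
split; first exact: us.
have := u0 j (mem_index_enum j); rewrite jA -scalemxAl mxE mulf_eq0 (negbTE dj).
by move=> /eqP.
Qed.

Section Rays.
Variables (p : nat) (I : finType) (v : I -> 'rV[rat]_p) (t : nat) (r : 'I_t -> 'rV[int]_p).
Local Notation sigma := (pos v [set: I]%SET).
Local Notation r' := (ratv \o r).
Hypothesis rP : extreme_vectors sigma r.

Lemma ray_face i : is_face sigma (pos r' [set i]).
Proof. by case: rP => /(_ i)[]. Qed.

Lemma ray_in_cone i : sigma (r' i).
Proof.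
have [c _ eqF] := ray_face i.
have : pos r' [set i] (r' i) by apply: pos_gen; rewrite inE.
by rewrite eqF => -[].
Qed.

Lemma ray_neq0 i : r' i != 0.
Proof.
apply/eqP => r0; case: rP => /(_ i)[_ [U [UP Umin dU]]] _ _.
suff /dimvS : (U <= 0)%VS by rewrite dU dimv0.
apply: Umin => _ [d _ ->]; rewrite big_set1 r0 scaler0; exact: mem0v.
Qed.

(** Ray i is a face, so all the rays that occur in an expression of r i lie on ray
    i; distinct indices give distinct rays. *)
Lemma ray_mem E i : pos r' E (r' i) -> i \in E.
Proof.
move=> [d d0 rE].
have [j jE dj] : exists2 j, j \in E & d j != 0.
  apply/exists_inP; apply: contraT; rewrite negb_exists => /forallP dN.
  move: (ray_neq0 i); rewrite rE big1 ?eqxx // => j jE.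
  by have := dN j; rewrite jE /= negbK => /eqP ->; rewrite scale0r.
have : pos r' [set i] (r' j).
  apply: (face_sum (ray_face i) _ d0 _ jE dj) => [k _|]; first exact: ray_in_cone.
  by rewrite -rE; apply: pos_gen; rewrite inE.
move=> [e e0]; rewrite big_set1 => rj.
have ei : 0 < e i.
  rewrite lt0r e0 ?inE // andbT; apply/eqP => ei.
  by have := ray_neq0 j; rewrite rj ei scale0r eqxx.
suff -> : i = j by [].
case: rP => _ + _; apply; apply/seteqP; split=> _ [l l0 ->]; rewrite big_set1.
  have -> : r' i = (e i)^-1 *: r' j by rewrite rj scalerA mulVf ?scale1r ?gt_eqF.
  apply: posZ; first by rewrite l0 ?inE.
  by apply: posZ; [rewrite invr_ge0 ltW|apply: pos_gen; rewrite inE].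
apply: posZ; first by rewrite l0 ?inE.
by rewrite rj; apply: posZ; [rewrite ltW|apply: pos_gen; rewrite inE].
Qed.

(** An expression of x in the second cone uses only rays that belong to the face
    spanned by E1. *)
Lemma face_capI E1 E2 x : is_face sigma (pos r' E1) ->
  pos r' E1 x -> pos r' E2 x -> pos r' (E1 :&: E2) x.
Proof.
move=> E1f E1x [d d0 xE]; rewrite xE; apply: pos_sum => // i iE2 di.
apply: pos_gen; rewrite inE iE2 andbT; apply: ray_mem.
by rewrite xE in E1x; apply: (face_sum E1f _ d0 E1x) => // k _; apply: ray_in_cone.
Qed.

(** Minimality is about cones; it passes to index sets because pos r E determines
    E by [ray_mem]. *)
Lemma minimal_nonface_proper (E E' : {set 'I_t}) : minimal_nonface sigma r' E -> E' \proper E ->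
  is_face sigma (pos r' E').
Proof.
move=> [_ Emin] /properP[E'E [i iE iE']]; apply: contrapT => /Emin eqE.
case/negP: iE'; apply: ray_mem; rewrite eqE; first exact: pos_gen.
by move=> x; apply: posS.
Qed.

(** If there were no such relation, the functional of [exposing_functional] would
    expose pos r E: it vanishes on r i for i in E, as the v k occurring in r i lie
    on ray i, hence in pos r E. *)
Lemma nonface_relation E (T := [set k | `[< pos r' E (v k) >]]) :
    ~ is_face sigma (pos r' E) ->
  exists w : I -> rat, [/\ \sum_k w k *: v k = 0, forall k, k \notin T -> w k <= 0
                         & exists2 k, k \notin T & w k < 0].
Proof.
move=> Enf; apply: contrapT => noW; apply: Enf.
have [w w0 wT k kT|c c0 cT] := @exposing_functional _ _ v T.
  apply/eqP; rewrite eq_le wT //= leNgt; apply/negP => wk; apply: noW.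
  by exists w; split=> //; exists k.
have vT k : (k \in T) = `[< pos r' E (v k) >] by rewrite inE.
have csum (A : {pred I}) (d : I -> rat) :
    ((\sum_(k in A) d k *: v k) *m c) 0 0 = \sum_(k in A) d k * (v k *m c) 0 0.
  by rewrite mulmx_suml summxE; apply: eq_bigr => k _; rewrite -scalemxAl mxE.
exists c => [_ [d d0 ->]|].
  by rewrite csum sumr_ge0 // => k kI; rewrite mulr_ge0 ?d0.
apply/seteqP; split=> [_ [d d0 ->]|x [[d d0 ->]]].
  split; first by apply: pos_sum => // i _ _; apply: ray_in_cone.
  rewrite mulmx_suml summxE big1 // => i iE; rewrite -scalemxAl mxE.
  have [e e0 rE] := ray_in_cone i; rewrite rE csum big1 ?mulr0 // => k _.
  have [->|ek] := eqVneq (e k) 0; first by rewrite mul0r.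
  suff /eqP -> : (v k *m c) 0 0 == 0 by rewrite mulr0.
  rewrite cT vT; apply/asboolP; apply: (@posS _ _ _ [set i]); first by rewrite finset.sub1set.
  apply: (face_sum (ray_face i) _ e0 _ _ ek) => [j _||]; rewrite ?inE //.
    by apply: pos_gen; rewrite inE.
  by rewrite -rE; apply: pos_gen; rewrite inE.
rewrite csum => /eqP; rewrite psumr_eq0 => [/allP x0|k kI]; last by rewrite mulr_ge0 ?d0.
apply: pos_sum => // k kI dk; apply/asboolP; rewrite -vT -cT.
by have := x0 k (mem_index_enum k); rewrite kI mulf_eq0 (negbTE dk).
Qed.

End Rays.

(** * Inclusion-exclusion and indicator points *)

Section InclusionExclusion.
Variables (A : zmodType) (I : finType) (M : eqType) (s : seq M) (c : M -> A).
Variables (chi : {set I} -> pred M) (E : {set I}).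
Hypothesis chiI : forall (U W : {set I}) m, U \subset E -> W \subset E ->
  chi (U :&: W) m = chi U m && chi W m.
Hypothesis chi0 : forall W : {set I}, W \proper E -> \sum_(m <- s | chi W m) c m = 0.

(** Removing from the sum those m with chi (W \ i), one i at a time, changes
    nothing: they contribute a sieved sum over the proper subset W \ i, which
    vanishes by induction. *)
Lemma sum_sieve_seq (l : seq I) (W : {set I}) : W \subset E -> {subset l <= W} -> uniq l ->
  \sum_(m <- s | chi W m && all (fun i => ~~ chi (W :\ i) m) l) c m
    = \sum_(m <- s | chi W m) c m.
Proof.
elim: l W => [|i l IH] W WE lW; first by move=> _; apply: eq_bigl => m; rewrite andbT.
move=> /andP[il l_uniq].
have iW : i \in W by apply: lW; rewrite mem_head.
have lW' : {subset l <= W} by move=> j jl; apply: lW; rewrite inE jl orbT.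
have WDE j : W :\ j \subset E by apply: fintype.subset_trans WE; apply: subD1set.
rewrite -(IH W) // [RHS](bigID (chi (W :\ i))) /=.
rewrite [X in _ = X + _](_ : _ = 0) ?add0r.
  by apply: eq_bigl => m; rewrite -andbA; congr (_ && _); rewrite andbC.
rewrite -[RHS](@chi0 (W :\ i)) -?[RHS]IH //.
- apply: eq_bigl => m; rewrite andbAC.
  rewrite (_ : chi W m && chi (W :\ i) m = chi (W :\ i) m); last first.
    by rewrite -chiI // (finset.setIidPr _) // subD1set.
  case Wim : (chi (W :\ i) m) => //=; apply: eq_in_all => j jl.
  have -> : W :\ i :\ j = (W :\ j) :&: (W :\ i).
    by apply/setP=> k; rewrite !inE; case: (k \in W); rewrite ?andbF ?andbT.
  by rewrite chiI // Wim andbT.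
- by move=> j jl; rewrite !inE lW' // andbT; apply: contraNneq il => <-.
- by apply: fintype.proper_sub_trans WE; apply: properD1.
Qed.

Lemma sum_sieve :
  \sum_(m <- s | chi E m && [forall i in E, ~~ chi (E :\ i) m]) c m
    = \sum_(m <- s | chi E m) c m.
Proof.
rewrite -(@sum_sieve_seq (enum E)) ?enum_uniq //; last by move=> i; rewrite mem_enum.
apply: eq_bigl => m; congr (_ && _); apply/forall_inP/allP => H i; last first.
  by move=> iE; apply: H; rewrite mem_enum.
by rewrite mem_enum; apply: H.
Qed.

End InclusionExclusion.

Section IndicatorPoints.
Variables (K : fieldType) (n : nat).
Implicit Types (T : {set 'I_n}) (m : 'X_{1..n}).

Definition supported T m := [forall k, (m k != 0)%N ==> (k \in T)].

Definition indicator T : 'I_n -> K := fun k => (k \in T)%:R.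

Lemma supportedP T m : reflect (forall k, m k != 0%N -> k \in T) (supported T m).
Proof. by apply: (iffP forallP) => H k; [apply/implyP: (H k)|apply/implyP/H]. Qed.

Lemma supportedI T T' m : supported (T :&: T') m = supported T m && supported T' m.
Proof.
apply/supportedP/andP => [H|[/supportedP H /supportedP H'] k mk].
  by split; apply/supportedP => k /H; rewrite inE => /andP[].
by rewrite inE H // H'.
Qed.

Lemma prod_indicator T m : \prod_k indicator T k ^+ m k = (supported T m)%:R.
Proof.
have [/supportedP mT|] := boolP (supported T m).
  rewrite big1 // => k _; have [->|/mT kT] := eqVneq (m k) 0%N; first by rewrite expr0.
  by rewrite /indicator kT expr1n.
rewrite negb_forall => /existsP[k]; rewrite negb_imply => /andP[mk kT].
by rewrite (bigD1 k) //= /indicator (negbTE kT) expr0n (negbTE mk) mul0r.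
Qed.

Lemma mevalX_indicator T m : ('X_[m] : {mpoly K[n]}).@[indicator T] = (supported T m)%:R.
Proof. by rewrite mevalX prod_indicator. Qed.

Lemma meval_indicator T (f : {mpoly K[n]}) :
  f.@[indicator T] = \sum_(m <- msupp f | supported T m) f@_m.
Proof.
rewrite mevalE [RHS]big_mkcond; apply: eq_bigr => m _.
by rewrite prod_indicator; case: ifP; rewrite ?mulr1 ?mulr0.
Qed.

End IndicatorPoints.

(** * Degrees and monomials over nonfaces *)

Lemma exponent_pos_part (n : nat) (u : 'rV[int]_n) :
  exponent (pos_part u) = u + exponent (neg_part u).
Proof.
apply/rowP => i; rewrite !mxE !mnmE mxE /Num.max.
by move: (u 0 i) => x; case: (ltP x 0) => ?; case: (ltP (- x) 0) => ?; lia.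
Qed.

Section Degrees.
Variables (n : nat).

Lemma gdegD (G : zmodType) (g : 'I_n -> G) u w : gdeg g (u + w) = gdeg g u + gdeg g w.
Proof. by rewrite /gdeg -big_split; apply: eq_bigr => i _; rewrite !mxE mulrzDr. Qed.

Lemma gdegN (G : zmodType) (g : 'I_n -> G) u : gdeg g (- u) = - gdeg g u.
Proof. by rewrite /gdeg -sumrN; apply: eq_bigr => i _; rewrite !mxE mulrNz. Qed.

Lemma gdeg_parts (G : zmodType) (g : 'I_n -> G) u : relations g u ->
  gdeg g (exponent (pos_part u)) = gdeg g (exponent (neg_part u)).
Proof. by move=> ug; rewrite exponent_pos_part gdegD ug add0r. Qed.

Lemma sub_Sat (L : set 'rV[int]_n) u : L u -> Sat L u.
Proof. by move=> Lu; exists 1; rewrite ?oner_eq0 // scale1r. Qed.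

Lemma ratv_gdeg p (a : 'I_n -> 'rV[int]_p) u :
  ratv (gdeg a u) = \sum_k (u 0 k)%:~R *: ratv (a k).
Proof.
rewrite /ratv /gdeg raddf_sum; apply: eq_bigr => k _.
by apply/rowP => j; rewrite !mxE -scaler_int !mxE /= intrM intz.
Qed.

Lemma homogeneous_mono (K : fieldType) (F H : zmodType) (f : 'I_n -> F) (h : 'I_n -> H)
    (P : {mpoly K[n]}) :
  (forall u, relations f u -> relations h u) -> homogeneous f P -> homogeneous h P.
Proof.
move=> fh Pf m m' mP m'P; apply/eqP; rewrite -subr_eq0 -gdegN -gdegD; apply/eqP/fh.
by rewrite /relations /= gdegD gdegN (Pf _ _ mP m'P) subrr.
Qed.

End Degrees.

Lemma clear_denominators (I : finType) (w : I -> rat) :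
  exists2 N : int, 0 < N & exists z : I -> int, forall i, (z i)%:~R = N%:~R * w i.
Proof.
exists (\prod_i denq (w i)); first by apply: prodr_gt0 => i _; apply: denq_gt0.
exists (fun i => numq (w i) * \prod_(j | j != i) denq (w j)) => i.
rewrite [\prod_i _](bigD1 i) //= !rmorphM /= mulrAC; congr (_ * _).
by rewrite numqE mulrC.
Qed.

Section Nonfaces.
Variables (K : fieldType) (n : nat) (G : zmodType) (g : 'I_n -> G).
Variables (p : nat) (a : 'I_n -> 'rV[int]_p) (satA : Sat (relations g) = relations a).
Variables (t : nat) (r : 'I_t -> 'rV[int]_p).
Local Notation sigma := (pos (ratv \o a) [set: 'I_n]%SET).
Local Notation r' := (ratv \o r).
Local Notation deg m := (ratv (gdeg a (exponent m))).
Hypothesis rP : extreme_vectors sigma r.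

(** The coordinates where the point x_W described at the top takes the value 1. *)
Definition cone_vars (W : {set 'I_t}) : {set 'I_n} := [set k | `[< pos r' W (ratv (a k)) >]].

Lemma degE m : deg m = \sum_k (m k)%:R *: ratv (a k).
Proof. by rewrite ratv_gdeg; apply: eq_bigr => k _; rewrite mxE. Qed.

Lemma pos_deg W m : supported (cone_vars W) m -> pos r' W (deg m).
Proof.
move=> /supportedP mW; rewrite degE; apply: pos_sum => k _ //; rewrite pnatr_eq0 => /mW.
by rewrite inE => /asboolP.
Qed.

(** This converse of [pos_deg] is the face property: the degree of m is a sum of
    generators a k. *)
Lemma face_deg W m : is_face sigma (pos r' W) -> pos r' W (deg m) -> supported (cone_vars W) m.
Proof.
move=> Wf mW; apply/supportedP => k mk; rewrite inE; apply/asboolP.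
rewrite degE in mW.
apply: (face_sum Wf _ _ mW) => // [j _|]; last by rewrite pnatr_eq0.
by apply: (@pos_gen _ _ (ratv \o a)).
Qed.

(** The two monomials of a binomial of the lattice ideal have the same degree, so
    both or neither are supported on the variables of the face. *)
Lemma face_point W (P : {mpoly K[n]}) : is_face sigma (pos r' W) ->
  radical (lattice_ideal K (relations g)) P -> P.@[indicator K (cone_vars W)] = 0.
Proof.
move=> Wf; apply: meval_radical => _ [u ug ->]; rewrite mevalB !mevalX_indicator.
have ua : relations a u by rewrite -satA; apply: sub_Sat.
suff -> : supported (cone_vars W) (pos_part u) = supported (cone_vars W) (neg_part u).
  by rewrite subrr.
by apply/idP/idP => /pos_deg uW; apply: face_deg Wf _; [rewrite -gdeg_parts|rewrite gdeg_parts].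
Qed.

Variables (E : {set 'I_t}) (Emin : minimal_nonface sigma r' E).

(** The relation of [nonface_relation], made integral and then multiplied into the
    lattice of g, has its positive part supported on the variables of E, but not
    its negative part. *)
Lemma nonface_point : exists2 P : {mpoly K[n]},
  lattice_ideal K (relations g) P & P.@[indicator K (cone_vars E)] = 1.
Proof.
have [w [w0 wT [l lT wl]]] := nonface_relation rP Emin.1.
have [N N0 [z zE]] := clear_denominators w.
have zle k : (z k <= 0) = (w k <= 0).
  by rewrite -(@ler_int rat) zE pmulr_rle0 // ltr0z.
have zlt k : (z k < 0) = (w k < 0).
  by rewrite -(@ltr_int rat) zE pmulr_rlt0 // ltr0z.
have : relations a (\row_k z k).
  have ratv_inj : injective (@ratv p).
    by move=> x y /rowP xy; apply/rowP => j; have := xy j; rewrite !mxE; apply: intr_inj.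
  apply: ratv_inj; rewrite ratv_gdeg.
  rewrite (eq_bigr (fun k => N%:~R *: (w k *: ratv (a k)))) => [|k _]; last first.
    by rewrite mxE zE scalerA.
  by rewrite -scaler_sumr w0 scaler0 /ratv raddf0.
rewrite -satA => -[d d0 dz].
(* Taking |d| keeps the signs of z. *)
pose u : 'rV[int]_n := `|d| *: \row_k z k.
have ug : relations g u.
  rewrite /u; case: (ger0P d) => _ //; rewrite scaleNr.
  by rewrite /relations /= gdegN dz oppr0.
exists ('X_[pos_part u] - 'X_[neg_part u]); first by apply: ideal_gen; exists u.
rewrite mevalB !mevalX_indicator.
have -> : supported (cone_vars E) (pos_part u).
  apply/supportedP => k; apply: contraR => kT.
  have := wT k kT; rewrite -zle mnmE !mxE => zk.
  by rewrite (max_idPr _) // mulr_ge0_le0.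
have -> : supported (cone_vars E) (neg_part u) = false.
  have ul : neg_part u l != 0%N.
    rewrite mnmE !mxE -mulrN (max_idPl _) ?absz_eq0.
      by rewrite mulf_neq0 ?normr_eq0 // oppr_eq0 lt_eqF // zlt.
    by rewrite mulr_ge0 // oppr_ge0 ltW // zlt.
  by apply/supportedP => /(_ l ul); move/negP: lT; apply.
by rewrite subr0.
Qed.

(** If one of U and W is proper its cone is a face and [face_capI] applies;
    otherwise both are E. *)
Lemma cone_varsI (U W : {set 'I_t}) : U \subset E -> W \subset E ->
  cone_vars (U :&: W) = cone_vars U :&: cone_vars W.
Proof.
move=> UE WE; apply/setP=> k; rewrite !inE; apply/asboolP/andP => [kUW|].
  by split; apply/asboolP; apply: posS kUW; [apply: subsetIl|apply: subsetIr].
move=> [/asboolP kU /asboolP kW].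
have [UE'|] := boolP (U \proper E).
  by apply: (face_capI rP) => //; apply: minimal_nonface_proper UE'.
by rewrite properE UE /= negbK => EU; rewrite (finset.setIidPr (fintype.subset_trans WE EU)).
Qed.

(** The value of h i at the point of E is, by the sieve, the sum of the
    coefficients of the monomials that are supported there but not on the point of
    any E \ j; the degree of such a monomial is in the relative interior. *)
Lemma nonface_monomial s (h : 'I_s -> {mpoly K[n]}) :
    radical (lattice_ideal K (relations g)) = radical (ideal (range h)) ->
  exists i, exists2 m, m \in msupp (h i) & relint r' E (deg m).
Proof.
move=> rad.
have [i hi] : exists i, (h i).@[indicator K (cone_vars E)] != 0.
  apply: contrapT => h0; have [P PJ P1] := nonface_point.
  have Ph : radical (ideal (range h)) P by rewrite -rad; exists 1%N; rewrite expr1.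
  have /eqP := P1; rewrite (meval_radical _ Ph) ?(eq_sym 0) ?oner_eq0 // => _ [i _ <-].
  by apply/eqP; apply: contrapT => /negP hi; apply: h0; exists i.
exists i; apply: contrapT => noM; move/eqP: hi; apply.
rewrite meval_indicator -(@sum_sieve _ _ _ _ _ (fun W => supported (cone_vars W)) E).
- rewrite big_seq_cond big1 // => m /and3P[mh mE /forall_inP mN].
  case: noM; exists m => //; apply: pos_relint; first exact: pos_deg.
  move=> j jE mj; move/negP: (mN j jE); apply; apply: face_deg => //.
  by apply: (minimal_nonface_proper rP Emin); apply: properD1.
- by move=> U W m UE WE; rewrite cone_varsI // supportedI.
- move=> W WE; rewrite -meval_indicator; apply: face_point.
    exact: minimal_nonface_proper WE.
  rewrite rad; exists 1%N; rewrite expr1; apply: ideal_gen; by exists i.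
Qed.

End Nonfaces.

(** * The bounds on the arithmetical rank *)

(** Hilbert's basis theorem ensures that the minimum defining ara is over a
    nonempty set. *)
Lemma ara_attained (K : fieldType) (n : nat) (H : zmodType) (h : 'I_n -> H) J :
    homogeneous_ideal h J ->
  exists2 P : 'I_(ara h J) -> {mpoly K[n]}, forall i, homogeneous h (P i)
    & radical J = radical (ideal (range P)).
Proof.
move=> [Q Qh ->]; pose gen s := exists2 P : 'I_s -> {mpoly K[n]},
  forall i, homogeneous h (P i) & radical (ideal Q) = radical (ideal (range P)).
apply: (minimumP (P := gen) _).1.
have [s [P PQ QE]] := hilbert_basis_fun Q.
by exists s, P => [i|]; [apply/Qh/PQ|rewrite QE].
Qed.

Lemma lattice_ideal_homogeneous (K : fieldType) (n : nat) (G : zmodType) (g : 'I_n -> G) :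
  homogeneous_ideal g (lattice_ideal K (relations g)).
Proof.
eexists; last by [].
move=> _ [u ug ->] m m' mX m'X.
have degX x : x \in msupp ('X_[pos_part u] - 'X_[neg_part u] : {mpoly K[n]}) ->
    gdeg g (exponent x) = gdeg g (exponent (neg_part u)).
  by move=> /msuppB_le; rewrite mem_cat !msuppX !inE => /orP[] /eqP -> //; apply: gdeg_parts.
by rewrite (degX m) // (degX m').
Qed.

Section Bound.
Variables (K : fieldType) (n : nat) (G : zmodType) (g : 'I_n -> G).
Variables (p : nat) (a : 'I_n -> 'rV[int]_p) (satA : Sat (relations g) = relations a).
Variables (q : nat) (b : 'I_n -> 'rV[int]_q).
Variable pi : {linear 'rV[rat]_p -> 'rV[rat]_q}.
Hypothesis piE : forall i, pi (ratv (a i)) = ratv (b i).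
Variables (t : nat) (r : 'I_t -> 'rV[int]_p).
Local Notation sigma := (pos (ratv \o a) [set: 'I_n]%SET).
Hypothesis rP : extreme_vectors sigma r.

Lemma pi_ratv_gdeg u : pi (ratv (gdeg a u)) = ratv (gdeg b u).
Proof. by rewrite !ratv_gdeg linear_sum; apply: eq_bigr => k _; rewrite linearZ /= piE. Qed.

(** Assign to each minimal nonface E the index of a P i having a monomial over the
    relative interior of pos r E. The common degree of the monomials of P i shows
    that the E with index i form a simplex. *)
Lemma delta_le_homogeneous s (P : 'I_s -> {mpoly K[n]}) :
    (forall i, homogeneous b (P i)) ->
    radical (lattice_ideal K (relations g)) = radical (ideal (range P)) ->
  (delta (D_complex sigma (ratv \o r) pi) <= s)%N.
Proof.
move=> Pb rad.
have /choice [c cP] : forall E : nonface_type sigma (ratv \o r), exists i, exists2 m,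
    m \in msupp (P i) & relint (ratv \o r) (val E) (ratv (gdeg a (exponent m))).
  by move=> [E /= /asboolP Emin]; exact: (nonface_monomial satA rP Emin rad).
apply: (delta_le_fibers (c := c)) => i; rewrite inE; apply/asboolP.
have [[m0 m0P]|nom] := pselect (exists m, m \in msupp (P i)); last first.
  (* A polynomial without monomials is assigned to no E. *)
  exists 0 => E; rewrite inE => /eqP cE; have [m] := cP E; rewrite cE => mP _.
  by case: nom; exists m.
exists (ratv (gdeg b (exponent m0))) => E; rewrite inE => /eqP cE.
have [m] := cP E; rewrite cE => mP /(relint_image pi); rewrite pi_ratv_gdeg.
by rewrite (Pb i _ _ mP m0P).
Qed.

End Bound.

Theorem theorem3p10 (K : fieldType) (n : nat) (G F : zmodType)
    (g : 'I_n -> G) (f : 'I_n -> F)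
    (g_gen : generates g) (f_gen : generates f)
    (f_le_g : specialization K f g) (g_pos : positive_grading g)
    (p : nat) (a : 'I_n -> 'rV[int]_p) (satA : Sat (relations g) = relations a)
    (q : nat) (b : 'I_n -> 'rV[int]_q) (satB : Sat (relations f) = relations b)
    (pi : {linear 'rV[rat]_p -> 'rV[rat]_q})
    (piE : forall i, pi (ratv (a i)) = ratv (b i))
    (t : nat) (r : 'I_t -> 'rV[int]_p)
    (rP : extreme_vectors (pos (ratv \o a) [set: 'I_n]%SET) r) :
  let D := D_complex (pos (ratv \o a) [set: 'I_n]%SET) (ratv \o r) pi in
  let J := lattice_ideal K (relations g) in
  [/\ (chromatic_number (complement_graph (skeleton_graph D)) <= delta D)%N,
      (delta D <= ara b J)%N
    & (ara b J <= ara f J)%N].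
Proof.
move=> D J.
have Jf : homogeneous_ideal f J by apply/f_le_g/lattice_ideal_homogeneous.
have homog_b (P : {mpoly K[n]}) : homogeneous f P -> homogeneous b P.
  by apply: homogeneous_mono => u uf; rewrite -satB; apply: sub_Sat.
have Jb : homogeneous_ideal b J.
  by have [Q Qf ->] := Jf; exists Q => // P /Qf /homog_b.
split; first exact: chromatic_number_le_delta.
  have [P Pb rad] := ara_attained Jb.
  exact (delta_le_homogeneous satA piE rP Pb rad).
have [P Pf rad] := ara_attained Jf.
by apply: minimum_le; exists P => // i; apply/homog_b/Pf.
Qed.
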